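(* Let $\gamma\colon[a,b]\to\mathbf{R}^3$ be a rectifiable curve with length $L$ and width $w$. Then $$L\geq 3.7669\,w.$$ Furthermore, if $\gamma$ is closed (i.e. $\gamma(a)=\gamma(b)$), then $$L\geq \sqrt{\pi^2+16}\;w \;(>5.0862\,w).$$
   Context: A curve is a continuous map $\gamma\colon[a,b]\to\mathbf{R}^3$; its length $L$ is the supremum of $\sum_{i}\|\gamma(t_i)-\gamma(t_{i-1})\|$ over all partitions $a=t_0\le t_1\le\dots\le t_k=b$, and $\gamma$ is rectifiable if $L<\infty$. The width $w$ of $\gamma$ is the infimum of the distances between all pairs of parallel planes such that $\gamma([a,b])$ lies in the closed slab between them. *)

(* Defs.v *)
From Stdlib Require Import Reals Lra.
Open Scope R_scope.

Definition R3 : Type := (R * R * R)%type.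

Definition dot3 (p q : R3) : R :=
  let '(x1, y1, z1) := p in let '(x2, y2, z2) := q in x1 * x2 + y1 * y2 + z1 * z2.

Definition norm3 (p : R3) : R := sqrt (dot3 p p).

Definition sub3 (p q : R3) : R3 :=
  let '(x1, y1, z1) := p in let '(x2, y2, z2) := q in (x1 - x2, y1 - y2, z1 - z2).

Definition dist3 (p q : R3) : R := norm3 (sub3 p q).

Definition continuous_on_interval (gamma : R -> R3) (a b : R) : Prop :=
  forall t, a <= t <= b -> forall eps, 0 < eps -> exists delta, 0 < delta /\
    forall s, a <= s <= b -> Rabs (s - t) < delta -> dist3 (gamma s) (gamma t) < eps.

Fixpoint poly_sum (gamma : R -> R3) (t : nat -> R) (k : nat) : R :=
  match k with
  | O => 0
  | S k' => poly_sum gamma t k' + dist3 (gamma (t (S k'))) (gamma (t k'))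
  end.

Definition is_partition (a b : R) (t : nat -> R) (k : nat) : Prop :=
  t O = a /\ t k = b /\ (forall i, (i < k)%nat -> t i <= t (S i)).

Definition polygon_sums (gamma : R -> R3) (a b : R) : R -> Prop :=
  fun s => exists t k, is_partition a b t k /\ s = poly_sum gamma t k.

Definition rectifiable_with_length (gamma : R -> R3) (a b L : R) : Prop :=
  is_lub (polygon_sums gamma a b) L.

(* Distances between pairs of parallel planes {u.x = c} and {u.x = c + d}
   (u a unit normal, d >= 0) bounding a closed slab containing gamma([a,b]). *)
Definition slab_widths (gamma : R -> R3) (a b : R) : R -> Prop :=
  fun d => 0 <= d /\ exists (u : R3) (c : R), norm3 u = 1 /\
    forall t, a <= t <= b -> c <= dot3 u (gamma t) <= c + d.

Definition is_glb (E : R -> Prop) (m : R) : Prop :=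
  (forall x, E x -> m <= x) /\ (forall m', (forall x, E x -> m' <= x) -> m' <= m).

Definition curve_width (gamma : R -> R3) (a b w : R) : Prop :=
  is_glb (slab_widths gamma a b) w.

(* Main.v *)
(* Measure an inscribed polygon along a direction u and in the plane normal to u.

   Direction u: write U for the largest rise of the height function and D for its largest
   weighted dip h_i - 2 h_j + h_k with i <= j <= k.  The differences U(h) - U(-h) and
   D(h) - D(-h) are odd in u, so by Borsuk-Ulam both (nearly) vanish for some u.  For that
   u the polygon meets its two supporting planes alternately at four points, so the total
   variation of the height is at least 3w, and 4w if the polygon is closed.

   Plane: if the polygon is closed, its projection has variation at least 2w in every
   direction, so the planar length is at least PI w by Cauchy's formula.  Otherwise let k
   be the distance between the projected end points.  The variation in the direction at
   angle t to the normal of the chord is at least 2w - k sin t (close up by the chord) and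
   at least k sin t; at t = 0 it is at least 2w, so averaged over t and -t it is at least
   2w cos t.  Integrating the best of the three bounds gives the planar length 2.2781 w.

   The two parts combine as the legs of a right triangle. *)

Require Import Defs.
From Stdlib Require Import Reals Lra Lia Psatz ZArith.
From Coquelicot Require Import Coquelicot.
Open Scope R_scope.

(** * Alternating extrema of a sequence *)

Ltac abs_lra := unfold Rabs in *; repeat destruct Rcase_abs; lra.

Fixpoint rsum (f : nat -> R) (n : nat) : R :=
  match n with O => 0 | S k => rsum f k + f k end.

Lemma rsum_le f g n :
  (forall i, (i < n)%nat -> f i <= g i) -> rsum f n <= rsum g n.
Proof.
  induction n as [|n IH]; intros H; simpl; [lra|].
  apply Rplus_le_compat; [apply IH; intros; apply H; lia | apply H; lia].
Qed.

Lemma rsum_scal c f n : rsum (fun i => c * f i) n = c * rsum f n.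
Proof. induction n as [|n IH]; simpl; [|rewrite IH]; ring. Qed.

Lemma rsum_plus f g n : rsum (fun i => f i + g i) n = rsum f n + rsum g n.
Proof. induction n as [|n IH]; simpl; [|rewrite IH]; ring. Qed.

Definition variation (h : nat -> R) (n : nat) : R :=
  rsum (fun i => Rabs (h (S i) - h i)) n.

Lemma variation_increment h i j : (i <= j)%nat ->
  Rabs (h j - h i) <= variation h j - variation h i.
Proof.
  induction 1 as [|j _ IH].
  - rewrite !Rminus_diag, Rabs_R0; lra.
  - unfold variation in *; simpl.
    replace (h (S j) - h i) with ((h (S j) - h j) + (h j - h i)) by ring.
    pose proof (Rabs_triang (h (S j) - h j) (h j - h i)); lra.
Qed.

(** Closed up by the step from [h n] back to [h 0], the sequence is a cycle through both heights,
    and a cycle travels between them twice. *)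
Lemma variation_closed_range h n i j : (i <= n)%nat -> (j <= n)%nat ->
  2 * (h i - h j) <= variation h n + Rabs (h n - h 0%nat).
Proof.
  intros Hi Hj.
  assert (E : variation h 0 = 0) by reflexivity.
  destruct (Nat.le_ge_cases i j) as [Hij|Hij].
  - pose proof (variation_increment h 0 i ltac:(lia)).
    pose proof (variation_increment h i j Hij).
    pose proof (variation_increment h j n Hj).
    abs_lra.
  - pose proof (variation_increment h 0 j ltac:(lia)).
    pose proof (variation_increment h j i Hij).
    pose proof (variation_increment h i n Hi).
    abs_lra.
Qed.

Fixpoint smax (g : nat -> R) (n : nat) : R :=
  match n with O => g O | S k => Rmax (smax g k) (g (S k)) end.

Lemma smax_ge g n j : (j <= n)%nat -> g j <= smax g n.
Proof.
  induction n as [|n IH]; intros Hj; simpl.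
  - replace j with O by lia; lra.
  - destruct (Nat.eq_dec j (S n)) as [->|Hne]; [apply Rmax_r|].
    eapply Rle_trans; [apply IH; lia | apply Rmax_l].
Qed.

Lemma smax_attained g n : exists j, (j <= n)%nat /\ smax g n = g j.
Proof.
  induction n as [|n [j [Hj E]]]; simpl; [exists O; auto|].
  unfold Rmax; destruct Rle_dec; [exists (S n) | exists j]; auto.
Qed.

Lemma smax_close g g' n c :
  (forall j, (j <= n)%nat -> Rabs (g j - g' j) <= c) ->
  Rabs (smax g n - smax g' n) <= c.
Proof.
  intros H.
  destruct (smax_attained g n) as [j [Hj E]].
  destruct (smax_attained g' n) as [j' [Hj' E']].
  pose proof (smax_ge g n j' Hj'). pose proof (smax_ge g' n j Hj).
  pose proof (H j Hj). pose proof (H j' Hj').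
  abs_lra.
Qed.

(** The nested running maximum encodes the order of the indices: the inner [smax] stops at the outer
    index. Lipschitz bounds then follow from [smax_close]. [max_dip] adds one more level. *)
Definition max_rise (h : nat -> R) (n : nat) : R :=
  smax (fun k => h k + smax (fun j => - h j) k) n.

Definition max_dip (h : nat -> R) (n : nat) : R :=
  smax (fun k => h k + smax (fun j => - 2 * h j + smax h j) k) n.

(** Twice the odd part of [F]. For [max_rise] it compares the largest rise with the largest drop,
    for [max_dip] the deepest dip with the highest bump. *)
Definition skew (F : (nat -> R) -> nat -> R) (h : nat -> R) (n : nat) : R :=
  F h n - F (fun i => - h i) n.

Lemma max_rise_ge h n i j : (i <= j <= n)%nat -> h j - h i <= max_rise h n.
Proof.
  intros H.
  pose proof (smax_ge (fun k => h k + smax (fun j => - h j) k) n j ltac:(lia)).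
  pose proof (smax_ge (fun j => - h j) j i ltac:(lia)).
  unfold max_rise; simpl in *; lra.
Qed.

Lemma max_rise_attained h n :
  exists i j, (i <= j <= n)%nat /\ max_rise h n = h j - h i.
Proof.
  unfold max_rise.
  destruct (smax_attained (fun k => h k + smax (fun j => - h j) k) n) as [j [Hj ->]].
  destruct (smax_attained (fun j => - h j) j) as [i [Hi ->]].
  exists i, j; split; [lia | ring].
Qed.

Lemma max_dip_ge h n i j k : (i <= j <= k)%nat -> (k <= n)%nat ->
  h i - 2 * h j + h k <= max_dip h n.
Proof.
  intros H Hk.
  pose proof (smax_ge (fun k => h k + smax (fun j => - 2 * h j + smax h j) k) n k Hk).
  pose proof (smax_ge (fun j => - 2 * h j + smax h j) k j ltac:(lia)).
  pose proof (smax_ge h j i ltac:(lia)).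
  unfold max_dip; simpl in *; lra.
Qed.

Lemma max_dip_attained h n :
  exists i j k, (i <= j <= k)%nat /\ (k <= n)%nat /\ max_dip h n = h i - 2 * h j + h k.
Proof.
  unfold max_dip.
  destruct (smax_attained (fun k => h k + smax (fun j => - 2 * h j + smax h j) k) n)
    as [k [Hk ->]].
  destruct (smax_attained (fun j => - 2 * h j + smax h j) k) as [j [Hj ->]].
  destruct (smax_attained h j) as [i [Hi ->]].
  exists i, j, k; repeat split; try lia; ring.
Qed.

Lemma max_rise_close h h' n c :
  (forall j, (j <= n)%nat -> Rabs (h j - h' j) <= c) ->
  Rabs (max_rise h n - max_rise h' n) <= 2 * c.
Proof.
  intros H; apply smax_close; intros k Hk.
  assert (Rabs (smax (fun j => - h j) k - smax (fun j => - h' j) k) <= c).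
  { apply smax_close; intros j Hj; specialize (H j ltac:(lia)); abs_lra. }
  specialize (H k Hk); abs_lra.
Qed.

Lemma max_dip_close h h' n c :
  (forall j, (j <= n)%nat -> Rabs (h j - h' j) <= c) ->
  Rabs (max_dip h n - max_dip h' n) <= 4 * c.
Proof.
  intros H; apply smax_close; intros k Hk.
  assert (Rabs (smax (fun j => - 2 * h j + smax h j) k
                - smax (fun j => - 2 * h' j + smax h' j) k) <= 3 * c).
  { apply smax_close; intros j Hj.
    assert (Rabs (smax h j - smax h' j) <= c)
      by (apply smax_close; intros; apply H; lia).
    specialize (H j ltac:(lia)); abs_lra. }
  specialize (H k Hk); abs_lra.
Qed.

Lemma skew_close F K h h' n c :
  (forall h h' n c, (forall j, (j <= n)%nat -> Rabs (h j - h' j) <= c) ->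
     Rabs (F h n - F h' n) <= K * c) ->
  (forall j, (j <= n)%nat -> Rabs (h j - h' j) <= c) ->
  Rabs (skew F h n - skew F h' n) <= 2 * (K * c).
Proof.
  intros HF H; unfold skew.
  pose proof (HF h h' n c H).
  assert (Rabs (F (fun i => - h i) n - F (fun i => - h' i) n) <= K * c).
  { apply HF; intros j Hj; specialize (H j Hj); abs_lra. }
  abs_lra.
Qed.

(** The Lipschitz hypothesis is applied with [c = 0], where it says that [F] sees only the values up
    to index [n]; this replaces functional extensionality. *)
Lemma skew_odd F K h h' n :
  (forall h h' n c, (forall j, (j <= n)%nat -> Rabs (h j - h' j) <= c) ->
     Rabs (F h n - F h' n) <= K * c) ->
  (forall j, h' j = - h j) -> skew F h' n = - skew F h n.
Proof.
  intros HF H; unfold skew.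
  assert (Rabs (F (fun i => - h' i) n - F h n) <= K * 0).
  { apply HF; intros j _; rewrite H, Ropp_involutive, Rminus_diag, Rabs_R0; lra. }
  assert (Rabs (F h' n - F (fun i => - h i) n) <= K * 0).
  { apply HF; intros j _; rewrite H, Rminus_diag, Rabs_R0; lra. }
  rewrite Rmult_0_r in *; abs_lra.
Qed.

(* If rises and drops of nearly the full range both occur, two of the extremal
   indices chain into a nearly full dip or bump; balancing dips against bumps and
   chaining once more gives four alternating extrema. *)
Lemma variation_of_balanced h n r d :
  0 < d -> (exists i j, (i <= n)%nat /\ (j <= n)%nat /\ r <= h i - h j) ->
  Rabs (skew max_rise h n) < d -> Rabs (skew max_dip h n) < d ->
  3 * r - 30 * d <= variation h n /\
  (h 0%nat = h n -> 4 * r - 40 * d <= variation h n).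
Proof.
  intros Hd (i & j & Hi & Hj & Hr) H2 H3.
  destruct (smax_attained h n) as [iM [HiM EM]].
  destruct (smax_attained (fun i => - h i) n) as [im [Him Em]].
  set (M := h iM) in *. set (m := h im) in *. cbv beta in Em.
  assert (HM : forall k, (k <= n)%nat -> h k <= M)
    by (intros k Hk; rewrite <- EM; now apply smax_ge).
  assert (Hm : forall k, (k <= n)%nat -> m <= h k).
  { intros k Hk. pose proof (smax_ge (fun i => - h i) n k Hk) as E; simpl in E.
    fold m in Em; lra. }
  assert (HR : r <= M - m) by (pose proof (HM i Hi); pose proof (Hm j Hj); lra).
  unfold skew in H2, H3.
  (* Whichever of minimum and maximum comes first, [h] or [-h] has a full rise; balance passes it to
     the other at a cost of [d]. *)
  assert (B2 : M - m - d <= max_rise h n /\ M - m - d <= max_rise (fun i => - h i) n).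
  { destruct (Nat.le_ge_cases im iM) as [H|H].
    - pose proof (max_rise_ge h n im iM ltac:(lia)); unfold M, m in *; abs_lra.
    - pose proof (max_rise_ge (fun i => - h i) n iM im ltac:(lia)); unfold M, m in *;
        simpl in *; abs_lra. }
  destruct (max_rise_attained h n) as (a & b & Hab & E1).
  destruct (max_rise_attained (fun i => - h i) n) as (c & e & Hce & E2); simpl in E2.
  pose proof (HM b ltac:(lia)). pose proof (Hm a ltac:(lia)).
  pose proof (HM c ltac:(lia)). pose proof (Hm e ltac:(lia)).
  (* Heights at [a], [c], [e] are low, high, low, and at [c], [a], [b] high, low, high, each within
     [d] of its extremum. Balance supplies the other shape. *)
  assert (B3 : 2 * (M - m) - 5 * d <= max_dip h n
               /\ 2 * (M - m) - 5 * d <= max_dip (fun i => - h i) n).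
  { destruct (Nat.le_ge_cases a c) as [H'|H'].
    - pose proof (max_dip_ge (fun i => - h i) n a c e ltac:(lia) ltac:(lia)); simpl in *; abs_lra.
    - pose proof (max_dip_ge h n c a b ltac:(lia) ltac:(lia)); abs_lra. }
  destruct (max_dip_attained h n) as (i1 & i2 & i3 & Hi12 & Hi3 & F1).
  destruct (max_dip_attained (fun i => - h i) n) as (k1 & k2 & k3 & Hk12 & Hk3 & F2);
    simpl in F2.
  pose proof (HM i1 ltac:(lia)). pose proof (Hm i2 ltac:(lia)). pose proof (HM i3 ltac:(lia)).
  pose proof (Hm k1 ltac:(lia)). pose proof (HM k2 ltac:(lia)). pose proof (Hm k3 ltac:(lia)).
  assert (V0 : variation h 0 = 0) by reflexivity.
  assert (chain : forall p q s t, (p <= q <= s)%nat -> (s <= t <= n)%nat ->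
     Rabs (h p - h 0%nat) + Rabs (h q - h p) + Rabs (h s - h q) + Rabs (h t - h s)
       + Rabs (h n - h t) <= variation h n).
  { intros p q s t Hpq Hst.
    pose proof (variation_increment h 0 p ltac:(lia)).
    pose proof (variation_increment h p q ltac:(lia)).
    pose proof (variation_increment h q s ltac:(lia)).
    pose proof (variation_increment h s t ltac:(lia)).
    pose proof (variation_increment h t n ltac:(lia)). lra. }
  clear H2 H3 EM Em E1 E2 Hr.
  (* The heights of the dip [i1, i2, i3] and the bump [k1, k2, k3] are within [5 * d] of their
     extrema. Putting the earlier of [i1], [k1] before the other triple gives four alternating
     near-extrema. *)
  destruct (Nat.le_ge_cases i1 k1) as [H'|H'].
  - pose proof (chain i1 k1 k2 k3 ltac:(lia) ltac:(lia)) as C; clear chain.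
    assert (M - m - 10 * d <= Rabs (h k1 - h i1))
      by (rewrite Rabs_minus_sym; eapply Rle_trans; [|apply Rle_abs]; lra).
    assert (M - m - 10 * d <= Rabs (h k2 - h k1)) by (eapply Rle_trans; [|apply Rle_abs]; lra).
    assert (M - m - 10 * d <= Rabs (h k3 - h k2))
      by (rewrite Rabs_minus_sym; eapply Rle_trans; [|apply Rle_abs]; lra).
    pose proof (Rabs_pos (h i1 - h 0%nat)). pose proof (Rabs_pos (h n - h k3)).
    (* When the ends agree, they join into a fourth step, from the last extremum back to the
       first. *)
    split; [lra|intros E0].
    assert (M - m - 10 * d <= Rabs (h i1 - h 0%nat) + Rabs (h n - h k3))
      by (rewrite E0; abs_lra).
    lra.
  - pose proof (chain k1 i1 i2 i3 ltac:(lia) ltac:(lia)) as C; clear chain.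
    assert (M - m - 10 * d <= Rabs (h i1 - h k1)) by (eapply Rle_trans; [|apply Rle_abs]; lra).
    assert (M - m - 10 * d <= Rabs (h i2 - h i1))
      by (rewrite Rabs_minus_sym; eapply Rle_trans; [|apply Rle_abs]; lra).
    assert (M - m - 10 * d <= Rabs (h i3 - h i2)) by (eapply Rle_trans; [|apply Rle_abs]; lra).
    pose proof (Rabs_pos (h k1 - h 0%nat)). pose proof (Rabs_pos (h n - h i3)).
    split; [lra|intros E0].
    assert (M - m - 10 * d <= Rabs (h k1 - h 0%nat) + Rabs (h n - h i3))
      by (rewrite E0; abs_lra).
    lra.
Qed.

(** * An approximate Borsuk-Ulam theorem *)

(* Quadrant labels in Z/4; [turn] is the signed step between non-opposite labels. *)
Definition label (d x y : R) : Z :=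
  if Rle_dec d x then 0%Z else if Rle_dec x (- d) then 2%Z
  else if Rle_dec d y then 1%Z else 3%Z.

Definition turn (p q : Z) : Z := ((q - p + 1) mod 4 - 1)%Z.

Fixpoint winding (l : nat -> Z) (n : nat) : Z :=
  match n with O => 0%Z | S k => (winding l k + turn (l k) (l (S k)))%Z end.

Lemma label_cases d x y :
  label d x y = 0%Z \/ label d x y = 1%Z \/ label d x y = 2%Z \/ label d x y = 3%Z.
Proof. unfold label; repeat destruct Rle_dec; auto. Qed.

Lemma label_opp d x y : 0 < d -> (Rabs x < d -> d <= Rabs y) ->
  label d (- x) (- y) = ((label d x y + 2) mod 4)%Z.
Proof.
  intros Hd H; unfold label.
  repeat destruct Rle_dec; try reflexivity; exfalso; try lra.
  - assert (Hx : Rabs x < d) by (apply Rabs_def1; lra). specialize (H Hx).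
    unfold Rabs in H; destruct Rcase_abs; lra.
Qed.

(** Labels 0 and 2 force a gap of [2 * d] in [x]. Labels 1 and 3 force both [|x|] below [d], hence
    both [|y|] at least [d] with opposite signs, a gap of [2 * d] in [y]. *)
Lemma label_not_opposite d x y x' y' :
  (Rabs x < d -> d <= Rabs y) -> (Rabs x' < d -> d <= Rabs y') ->
  Rabs (x - x') < 2 * d -> Rabs (y - y') < 2 * d ->
  ((label d x y - label d x' y') mod 4 <> 2)%Z.
Proof.
  intros H H' Hx Hy; unfold label.
  repeat destruct Rle_dec; try discriminate; exfalso;
  try (apply Rabs_def2 in Hx; lra).
  all: assert (A : Rabs x < d) by (apply Rabs_def1; lra);
       assert (A' : Rabs x' < d) by (apply Rabs_def1; lra);
       specialize (H A); specialize (H' A');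
       unfold Rabs in H, H', Hy; repeat destruct Rcase_abs; lra.
Qed.

(** Pairwise non-opposite labels occupy at most two adjacent quadrants, so they lift to integers
    whose differences are the turns. *)
Lemma turn_square p q r s :
  (0 <= p < 4)%Z -> (0 <= q < 4)%Z -> (0 <= r < 4)%Z -> (0 <= s < 4)%Z ->
  ((p - q) mod 4 <> 2)%Z -> ((p - r) mod 4 <> 2)%Z -> ((p - s) mod 4 <> 2)%Z ->
  ((q - r) mod 4 <> 2)%Z -> ((q - s) mod 4 <> 2)%Z -> ((r - s) mod 4 <> 2)%Z ->
  (turn p q + turn q s = turn p r + turn r s)%Z.
Proof.
  intros Hp Hq Hr Hs.
  assert (C : forall z, (0 <= z < 4)%Z -> (z = 0 \/ z = 1 \/ z = 2 \/ z = 3)%Z) by lia.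
  destruct (C p Hp) as [->|[->|[->| ->]]], (C q Hq) as [->|[->|[->| ->]]],
    (C r Hr) as [->|[->|[->| ->]]], (C s Hs) as [->|[->|[->| ->]]];
    vm_compute; intros; congruence.
Qed.

Lemma turn_shift p q : turn ((p + 2) mod 4) ((q + 2) mod 4) = turn p q.
Proof.
  unfold turn; f_equal.
  rewrite <- Zplus_mod_idemp_l, Zminus_mod_idemp_l, Zminus_mod_idemp_r, Zplus_mod_idemp_l.
  f_equal; lia.
Qed.

Lemma winding_mod l n : ((winding l n - (l n - l O)) mod 4 = 0)%Z.
Proof.
  induction n as [|n IH]; simpl winding.
  - now rewrite Z.sub_diag.
  - apply Z.mod_divide in IH; [|lia]. apply Z.mod_divide; [lia|].
    unfold turn. pose proof (Z.div_mod (l (S n) - l n + 1) 4 ltac:(lia)).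
    destruct IH as [k Hk].
    exists (k - (l (S n) - l n + 1) / 4)%Z. lia.
Qed.

Lemma winding_const l n : (forall i, (i <= n)%nat -> l i = l O) -> winding l n = 0%Z.
Proof.
  induction n as [|n IH]; intros H; simpl; auto.
  rewrite IH by (intros; apply H; lia). rewrite (H n), (H (S n)) by lia.
  unfold turn; rewrite Z.sub_diag; reflexivity.
Qed.

Lemma winding_add l n m :
  winding l (n + m) = (winding l n + winding (fun i => l (n + i)%nat) m)%Z.
Proof.
  induction m as [|m IH]; simpl; [rewrite Nat.add_0_r; lia|].
  rewrite Nat.add_succ_r; simpl; rewrite IH; lia.
Qed.

(** The first half winds by 2 mod 4, its end labels being opposite. By [turn_shift] the second half
    winds equally, so the total is 4 mod 8. *)
Lemma winding_antipodal l n :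
  (forall i, (i <= n)%nat -> l (n + i)%nat = ((l i + 2) mod 4)%Z) ->
  winding l (n + n) <> 0%Z.
Proof.
  intros H. rewrite winding_add.
  assert (E : forall k, (k <= n)%nat ->
    winding (fun i => l (n + i)%nat) k = winding l k).
  { induction k as [|k IH]; intros Hk; simpl; auto.
    rewrite IH, !H, turn_shift by lia; auto. }
  rewrite E by lia.
  pose proof (winding_mod l n) as W. pose proof (H O ltac:(lia)) as H0.
  rewrite Nat.add_0_r in H0. rewrite H0 in W.
  intros E0. assert (winding l n = 0)%Z by lia.
  pose proof (Z.div_mod (l O + 2) 4 ltac:(lia)).
  apply Z.mod_divide in W; [|lia]. destruct W as [k Hk]. lia.
Qed.

(** The square identities telescope: all rungs between the two rows cancel except the first and the
    last. *)
Lemma winding_homotopy l l' n :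
  (forall i, (i < n)%nat ->
     (turn (l i) (l (S i)) + turn (l (S i)) (l' (S i))
      = turn (l i) (l' i) + turn (l' i) (l' (S i)))%Z) ->
  (winding l n + turn (l n) (l' n) = turn (l O) (l' O) + winding l' n)%Z.
Proof.
  induction n as [|n IH]; intros H; simpl; [lia|].
  pose proof (IH ltac:(intros; apply H; lia)). pose proof (H n ltac:(lia)). lia.
Qed.

(* Without a common near-zero, adjacent rows of labels have the same winding number, which
   is 0 for the constant row 0 but odd for the antipodal row m. *)
Lemma grid_zero (f g : nat -> nat -> R) (n m : nat) (d : R) :
  0 < d ->
  (forall i j, Rabs (f (S i) j - f i j) < d /\ Rabs (g (S i) j - g i j) < d) ->
  (forall i j, Rabs (f i (S j) - f i j) < d /\ Rabs (g i (S j) - g i j) < d) ->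
  (forall i, f i O = f O O /\ g i O = g O O) ->
  (forall j, f (n + n)%nat j = f O j /\ g (n + n)%nat j = g O j) ->
  (forall i, f (n + i)%nat m = - f i m /\ g (n + i)%nat m = - g i m) ->
  exists i j, Rabs (f i j) < d /\ Rabs (g i j) < d.
Proof.
  intros Hd Hi Hj H0 Hper Hanti.
  apply Classical_Prop.NNPP; intros Hno.
  assert (Hbig : forall i j, Rabs (f i j) < d -> d <= Rabs (g i j)).
  { intros i j Hf. apply Rnot_lt_le; intros Hg. apply Hno; now exists i, j. }
  set (l := fun j i => label d (f i j) (g i j)).
  assert (R4 : forall j i, (0 <= l j i < 4)%Z).
  { intros j i; unfold l. destruct (label_cases d (f i j) (g i j)) as [->|[->|[->| ->]]]; lia. }
  assert (W : forall j, winding (l j) (n + n) = 0%Z).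
  { induction j as [|j IH].
    - apply winding_const; intros i _; unfold l. destruct (H0 i) as [-> ->]; reflexivity.
    - assert (Hh : (winding (l j) (n + n) + turn (l j (n + n)%nat) (l (S j) (n + n)%nat)
                    = turn (l j O) (l (S j) O) + winding (l (S j)) (n + n))%Z).
      { apply winding_homotopy; intros i _.
        destruct (Hi i j) as [A1 A2], (Hi i (S j)) as [B1 B2],
          (Hj i j) as [C1 C2], (Hj (S i) j) as [D1 D2].
        apply Rabs_def2 in A1, A2, B1, B2, C1, C2, D1, D2.
        apply turn_square; auto; unfold l; apply label_not_opposite; auto;
          apply Rabs_def1; lra. }
      (* By periodicity the first and last rungs agree and cancel. *)
      assert (E : l j (n + n)%nat = l j O /\ l (S j) (n + n)%nat = l (S j) O).
      { unfold l. destruct (Hper j) as [-> ->], (Hper (S j)) as [-> ->]; auto. }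
      destruct E as [E1 E2]; rewrite E1, E2, IH in Hh; clear - Hh; lia. }
  apply (winding_antipodal (l m) n); auto.
  intros i _; unfold l. destruct (Hanti i) as [-> ->].
  apply label_opp; auto.
Qed.

(** * Sampling odd Lipschitz functions on the sphere *)

Definition dist1 (p q : R3) : R :=
  let '(x, y, z) := p in let '(x', y', z') := q in
  Rabs (x - x') + Rabs (y - y') + Rabs (z - z').

Definition opp3 (p : R3) : R3 := let '(x, y, z) := p in (- x, - y, - z).

Definition sphere_point (t s : R) : R3 := (cos t * sin s, sin t * sin s, cos s).

Lemma sphere_point_unit t s : norm3 (sphere_point t s) = 1.
Proof.
  unfold norm3, sphere_point, dot3. rewrite <- sqrt_1; f_equal.
  pose proof (sin2_cos2 t) as Ht. pose proof (sin2_cos2 s) as Hs. unfold Rsqr in *.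
  transitivity ((sin t * sin t + cos t * cos t) * (sin s * sin s) + cos s * cos s); [ring|].
  rewrite Ht; lra.
Qed.

Lemma trig_lipschitz x y :
  Rabs (cos x - cos y) <= Rabs (x - y) /\ Rabs (sin x - sin y) <= Rabs (x - y).
Proof.
  assert (HS : forall z, Rabs (sin z) <= Rabs z).
  { intros z.
    assert (A : forall z, 0 <= z -> Rabs (sin z) <= z).
    { intros v Hv. destruct (Req_dec v 0) as [->|Hne].
      - rewrite sin_0, Rabs_R0; lra.
      - pose proof (sin_lt_x v ltac:(lra)). pose proof (SIN_bound v).
        apply Rabs_le; split; [|lra].
        destruct (Rle_dec v PI) as [Hp|Hp].
        + pose proof (sin_ge_0 v ltac:(lra) Hp); lra.
        + pose proof PI2_1. lra. }
    destruct (Rle_dec 0 z) as [Hz|Hz].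
    - rewrite (Rabs_pos_eq z) by lra; auto.
    - rewrite (Rabs_left z) by lra. rewrite <- Rabs_Ropp, <- sin_neg. apply A; lra. }
  assert (H2 : Rabs (sin ((x - y) / 2)) <= Rabs (x - y) / 2).
  { eapply Rle_trans; [apply HS|]. unfold Rdiv. rewrite Rabs_mult, (Rabs_pos_eq (/ 2)); lra. }
  split.
  - rewrite form2, !Rabs_mult, Rabs_left by lra.
    pose proof (SIN_bound ((x + y) / 2)).
    assert (Rabs (sin ((x + y) / 2)) <= 1) by (apply Rabs_le; lra).
    pose proof (Rabs_pos (sin ((x - y) / 2))). pose proof (Rabs_pos (sin ((x + y) / 2))). nra.
  - rewrite form4, !Rabs_mult, Rabs_pos_eq by lra.
    pose proof (COS_bound ((x + y) / 2)).
    assert (Rabs (cos ((x + y) / 2)) <= 1) by (apply Rabs_le; lra).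
    pose proof (Rabs_pos (sin ((x - y) / 2))). pose proof (Rabs_pos (cos ((x + y) / 2))). nra.
Qed.

Lemma Rabs_prod_diff a b c d : Rabs a <= 1 -> Rabs d <= 1 ->
  Rabs (a * b - c * d) <= Rabs (a - c) + Rabs (b - d).
Proof.
  intros Ha Hd. replace (a * b - c * d) with (a * (b - d) + (a - c) * d) by ring.
  eapply Rle_trans; [apply Rabs_triang|]. rewrite !Rabs_mult.
  pose proof (Rabs_pos (b - d)). pose proof (Rabs_pos (a - c)). nra.
Qed.

Lemma sphere_point_lipschitz t s t' s' :
  dist1 (sphere_point t s) (sphere_point t' s') <= 3 * (Rabs (t - t') + Rabs (s - s')).
Proof.
  unfold dist1, sphere_point.
  assert (B : forall z, Rabs (cos z) <= 1 /\ Rabs (sin z) <= 1)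
    by (intros z; pose proof (COS_bound z); pose proof (SIN_bound z);
        split; apply Rabs_le; lra).
  destruct (trig_lipschitz t t'), (trig_lipschitz s s').
  pose proof (Rabs_prod_diff (cos t) (sin s) (cos t') (sin s')
                (proj1 (B t)) (proj2 (B s'))).
  pose proof (Rabs_prod_diff (sin t) (sin s) (sin t') (sin s')
                (proj2 (B t)) (proj2 (B s'))).
  pose proof (Rabs_pos (t - t')). pose proof (Rabs_pos (s - s')). lra.
Qed.

(** The grid has longitude steps [PI / n] and colatitude steps half as large: row 0 is the pole, row
    [n] the equator, where oddness gives the antipodal condition of [grid_zero]. *)
Lemma borsuk_ulam_approx (f g : R3 -> R) (K d : R) :
  0 < d ->
  (forall p q, Rabs (f p - f q) <= K * dist1 p q) ->
  (forall p q, Rabs (g p - g q) <= K * dist1 p q) ->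
  (forall p, f (opp3 p) = - f p) -> (forall p, g (opp3 p) = - g p) ->
  exists u, norm3 u = 1 /\ Rabs (f u) < d /\ Rabs (g u) < d.
Proof.
  intros Hd Hf Hg Of Og.
  assert (HK : 0 <= K).
  { pose proof (Hf (1, 0, 0) (0, 0, 0)) as H. pose proof (Rabs_pos (f (1, 0, 0) - f (0, 0, 0))).
    unfold dist1 in H. rewrite Rminus_0_r, Rminus_diag, Rabs_R0, Rabs_R1 in H. lra. }
  pose proof PI_RGT_0.
  (* [n] is chosen so that one grid step changes [f] and [g] by less than [d]; the 3 comes from
     [sphere_point_lipschitz]. *)
  destruct (INR_unbounded (3 * K * PI / d)) as [N HN].
  set (n := S N).
  assert (Hn : 3 * K * PI / d < INR n) by (unfold n; rewrite S_INR; lra).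
  assert (Hn0 : 0 < INR n) by (apply lt_0_INR; unfold n; lia).
  assert (step : 3 * K * (PI / INR n) < d).
  { apply (Rmult_lt_reg_r (INR n / d)).
    - apply Rdiv_lt_0_compat; lra.
    - replace (3 * K * (PI / INR n) * (INR n / d)) with (3 * K * PI / d) by (field; lra).
      replace (d * (INR n / d)) with (INR n) by (field; lra). exact Hn. }
  assert (Hq : 0 < PI / INR n) by (apply Rdiv_lt_0_compat; lra).
  set (v := fun i j => sphere_point (INR i * (PI / INR n)) (INR j * (PI / INR n / 2))).
  assert (close : forall F, (forall p q, Rabs (F p - F q) <= K * dist1 p q) ->
    forall i j, Rabs (F (v (S i) j) - F (v i j)) < d /\ Rabs (F (v i (S j)) - F (v i j)) < d).
  { intros F HF i j; split; (eapply Rle_lt_trans; [apply HF|]);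
      (eapply Rle_lt_trans; [apply Rmult_le_compat_l; [exact HK | apply sphere_point_lipschitz]|]);
      rewrite S_INR, Rminus_diag, Rabs_R0.
    - replace ((INR i + 1) * (PI / INR n) - INR i * (PI / INR n)) with (PI / INR n) by ring.
      rewrite Rabs_pos_eq by lra. lra.
    - replace ((INR j + 1) * (PI / INR n / 2) - INR j * (PI / INR n / 2))
        with (PI / INR n / 2) by (field; lra).
      rewrite Rabs_pos_eq by lra. nra. }
  destruct (grid_zero (fun i j => f (v i j)) (fun i j => g (v i j)) n n d Hd)
    as (i & j & Hz).
  - intros i j; split; now apply close.
  - intros i j; split; now apply close.
  - intros i.
    assert (E : v i O = v O O)
      by (unfold v, sphere_point; simpl; rewrite !Rmult_0_l, sin_0, !Rmult_0_r; reflexivity).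
    rewrite E; auto.
  - intros j.
    assert (E : v (n + n)%nat j = v O j).
    { unfold v, sphere_point. rewrite plus_INR.
      replace ((INR n + INR n) * (PI / INR n)) with (2 * PI) by (field; lra).
      simpl (INR 0). rewrite Rmult_0_l, cos_2PI, sin_2PI, cos_0, sin_0. reflexivity. }
    rewrite E; auto.
  - intros i.
    assert (E : v (n + i)%nat n = opp3 (v i n)).
    { unfold v, sphere_point, opp3. rewrite plus_INR.
      replace ((INR n + INR i) * (PI / INR n)) with (INR i * (PI / INR n) + PI) by (field; lra).
      replace (INR n * (PI / INR n / 2)) with (PI / 2) by (field; lra).
      rewrite neg_cos, neg_sin, cos_PI2, sin_PI2, Ropp_0.
      rewrite !Rmult_1_r; reflexivity. }
    rewrite E; auto.
  - exists (v i j); split; [apply sphere_point_unit | exact Hz].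
Qed.

Lemma dot3_lipschitz u v p :
  Rabs (dot3 u p - dot3 v p) <=
  (let '(x, y, z) := p in Rabs x + Rabs y + Rabs z) * dist1 u v.
Proof.
  destruct u as [[u1 u2] u3], v as [[v1 v2] v3], p as [[x y] z]; simpl.
  replace (u1 * x + u2 * y + u3 * z - (v1 * x + v2 * y + v3 * z))
    with ((u1 - v1) * x + (u2 - v2) * y + (u3 - v3) * z) by ring.
  pose proof (Rabs_triang ((u1 - v1) * x + (u2 - v2) * y) ((u3 - v3) * z)) as T1.
  pose proof (Rabs_triang ((u1 - v1) * x) ((u2 - v2) * y)) as T2.
  rewrite !Rabs_mult in *.
  pose proof (Rabs_pos x). pose proof (Rabs_pos y). pose proof (Rabs_pos z).
  pose proof (Rabs_pos (u1 - v1)). pose proof (Rabs_pos (u2 - v2)).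
  pose proof (Rabs_pos (u3 - v3)). nra.
Qed.

Lemma exists_balanced_direction (P : nat -> R3) n d : 0 < d ->
  exists u, norm3 u = 1 /\
    Rabs (skew max_rise (fun i => dot3 u (P i)) n) < d /\
    Rabs (skew max_dip (fun i => dot3 u (P i)) n) < d.
Proof.
  intros Hd.
  set (size := fun i => let '(x, y, z) := P i in Rabs x + Rabs y + Rabs z).
  set (B := smax size n).
  assert (HB : forall u v j, (j <= n)%nat ->
    Rabs (dot3 u (P j) - dot3 v (P j)) <= B * dist1 u v).
  { intros u v j Hj. eapply Rle_trans; [apply dot3_lipschitz|].
    apply Rmult_le_compat_r; [|exact (smax_ge size n j Hj)].
    destruct u as [[u1 u2] u3], v as [[v1 v2] v3]; simpl.
    repeat apply Rplus_le_le_0_compat; apply Rabs_pos. }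
  assert (HB0 : 0 <= B).
  { pose proof (smax_ge size n n (le_n n)) as H; fold B in H.
    assert (0 <= size n); [|lra].
    unfold size; destruct (P n) as [[x y] z].
    repeat apply Rplus_le_le_0_compat; apply Rabs_pos. }
  assert (Hopp : forall u j, dot3 (opp3 u) (P j) = - dot3 u (P j)).
  { intros [[u1 u2] u3] j; destruct (P j) as [[x y] z]; simpl; ring. }
  (* [max_dip] is 4-Lipschitz in the sup norm and [skew] doubles this, hence [8 * B]; the constant
     [4 * B] for [max_rise] is smaller. *)
  apply (borsuk_ulam_approx (fun u => skew max_rise (fun i => dot3 u (P i)) n)
    (fun u => skew max_dip (fun i => dot3 u (P i)) n) (8 * B)); auto.
  - intros u v.
    pose proof (skew_close max_rise 2 _ _ n _ max_rise_close (HB u v)) as H.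
    pose proof (Rabs_pos (skew max_rise (fun i => dot3 u (P i)) n
      - skew max_rise (fun i => dot3 v (P i)) n)).
    lra.
  - intros u v.
    pose proof (skew_close max_dip 4 _ _ n _ max_dip_close (HB u v)) as H. lra.
  - intros u; apply (skew_odd _ _ _ _ _ max_rise_close); auto.
  - intros u; apply (skew_odd _ _ _ _ _ max_dip_close); auto.
Qed.

(** * Orthonormal frames *)

Lemma dot3_self_nonneg p : 0 <= dot3 p p.
Proof. destruct p as [[x y] z]; simpl; nra. Qed.

Lemma norm3_sqr p : norm3 p * norm3 p = dot3 p p.
Proof. apply sqrt_sqrt, dot3_self_nonneg. Qed.

Definition cross3 (p q : R3) : R3 :=
  let '(x, y, z) := p in let '(x', y', z') := q in
  (y * z' - z * y', z * x' - x * z', x * y' - y * x').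

Definition scale3 (c : R) (p : R3) : R3 := let '(x, y, z) := p in (c * x, c * y, c * z).

Definition add3 (p q : R3) : R3 :=
  let '(x, y, z) := p in let '(x', y', z') := q in (x + x', y + y', z + z').

Lemma dot3_scale c p q : dot3 (scale3 c p) q = c * dot3 p q.
Proof. destruct p as [[x y] z], q as [[x' y'] z']; simpl; ring. Qed.

Lemma dot3_scale_r c p q : dot3 p (scale3 c q) = c * dot3 p q.
Proof. destruct p as [[x y] z], q as [[x' y'] z']; simpl; ring. Qed.

Lemma dot3_add p q r : dot3 (add3 p q) r = dot3 p r + dot3 q r.
Proof.
  destruct p as [[x y] z], q as [[x' y'] z'], r as [[x'' y''] z'']; simpl; ring.
Qed.

Lemma dot3_sub u p q : dot3 u (sub3 p q) = dot3 u p - dot3 u q.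
Proof. destruct u as [[x y] z], p as [[x' y'] z'], q as [[x'' y''] z'']; simpl; ring. Qed.

Lemma dot3_comm p q : dot3 p q = dot3 q p.
Proof. destruct p as [[x y] z], q as [[x' y'] z']; simpl; ring. Qed.

Lemma normalize p : dot3 p p <> 0 -> dot3 (scale3 (/ norm3 p) p) (scale3 (/ norm3 p) p) = 1.
Proof.
  intros H. pose proof (norm3_sqr p) as E.
  assert (norm3 p <> 0) by (intros E0; rewrite E0 in E; lra).
  rewrite dot3_scale, dot3_scale_r, <- E. field; auto.
Qed.

(** Used with [c] the chord of the polygon: in the plane normal to [u], the projected chord then
    lies along [cross3 u v]. *)
Lemma exists_normal (u c : R3) : dot3 u u = 1 ->
  exists v, dot3 v v = 1 /\ dot3 v u = 0 /\ dot3 v c = 0.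
Proof.
  intros Hu.
  assert (W : forall n, dot3 n n <> 0 -> dot3 n u = 0 -> dot3 n c = 0 ->
    exists v, dot3 v v = 1 /\ dot3 v u = 0 /\ dot3 v c = 0).
  { intros n Hn H1 H2. exists (scale3 (/ norm3 n) n).
    rewrite normalize by auto. rewrite !dot3_scale, H1, H2. repeat split; ring. }
  destruct (Req_dec (dot3 (cross3 u c) (cross3 u c)) 0) as [E|E].
  - (* [c] is parallel to [u]: any normal of [u] will do. *)
    assert (Hc : forall n, dot3 n u = 0 -> dot3 n c = 0).
    { destruct u as [[x y] z], c as [[a b] e]; simpl in *.
      assert (S : forall A B C, A * A + B * B + C * C = 0 -> A = 0 /\ B = 0 /\ C = 0).
      { intros A B C HS. repeat split; apply Rsqr_0_uniq; unfold Rsqr; nra. }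
      destruct (S _ _ _ E) as (H & H0 & H1).
      intros [[p q] r] Hn; simpl in *.
      replace (p * a + q * b + r * e) with
        ((p * a + q * b + r * e) * (x * x + y * y + z * z)) by (rewrite Hu; ring).
      (* Lagrange's identity for the cross products of [u] with [c] and with [n]. *)
      transitivity ((p * x + q * y + r * z) * (a * x + b * y + e * z)
        + (x * b - y * a) * (q * x - p * y) + (y * e - z * b) * (r * y - q * z)
        + (z * a - x * e) * (p * z - r * x)); [ring|].
      rewrite Hn, H, H0, H1; ring. }
    destruct u as [[x y] z]; simpl in Hu.
    destruct (Req_dec (x * x + y * y) 0) as [E0|E0].
    + apply (W (z, 0, - x)).
      * simpl; intros E1; nra.
      * simpl; ring.
      * apply Hc; simpl; ring.
    + apply (W (y, - x, 0)).
      * simpl; intros E1; nra.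
      * simpl; ring.
      * apply Hc; simpl; ring.
  - apply (W (cross3 u c)); auto;
      destruct u as [[x y] z], c as [[a b] e]; simpl; ring.
Qed.

(** Parseval in the frame [u], [v], [cross3 u v]; [H] is the Gram determinant identity for arbitrary
    vectors. *)
Lemma orthonormal_frame (u v e : R3) : dot3 u u = 1 -> dot3 v v = 1 -> dot3 v u = 0 ->
  dot3 e e = dot3 u e * dot3 u e + dot3 v e * dot3 v e
             + dot3 (cross3 u v) e * dot3 (cross3 u v) e.
Proof.
  intros Hu Hv Huv.
  assert (H : dot3 e e * (dot3 u u * dot3 v v - dot3 v u * dot3 v u)
     = dot3 u e * dot3 u e * dot3 v v + dot3 v e * dot3 v e * dot3 u u
       - 2 * dot3 u e * dot3 v e * dot3 v u
       + dot3 (cross3 u v) e * dot3 (cross3 u v) e).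
  { destruct u as [[x y] z], v as [[a b] c], e as [[p q] r]; simpl; ring. }
  rewrite Hu, Hv, Huv in H. lra.
Qed.

(** * Planar length from projections *)

Lemma ex_RInt_proj p q a b :
  ex_RInt (fun t => Rmax (p * cos t) (q * sin t)) a b.
Proof.
  apply (ex_RInt_ext (fun t => (p * cos t + q * sin t + Rabs (p * cos t - q * sin t)) / 2)).
  { intros t _. unfold Rmax; destruct Rle_dec; abs_lra. }
  apply (ex_RInt_continuous (V := R_CompleteNormedModule)); intros t _.
  apply continuity_pt_filterlim. unfold Rdiv. reg.
Qed.

Lemma is_RInt_cos p a b : is_RInt (fun t => p * cos t) a b (p * sin b - p * sin a).
Proof.
  apply (is_RInt_derive (V := R_CompleteNormedModule) (fun t => p * sin t)); intros t _.
  - auto_derive; auto; ring.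
  - apply continuity_pt_filterlim; reg.
Qed.

Lemma is_RInt_sin q a b : is_RInt (fun t => q * sin t) a b (q * cos a - q * cos b).
Proof.
  replace (q * cos a - q * cos b) with (- q * cos b - - q * cos a) by ring.
  apply (is_RInt_derive (V := R_CompleteNormedModule) (fun t => - q * cos t)); intros t _.
  - auto_derive; auto; ring.
  - apply continuity_pt_filterlim; reg.
Qed.

(* Cauchy's formula for a segment with coordinates of absolute values q and p: the maximum
   is the mean of its projections onto the directions at angles t and -t to the p-axis. *)
Lemma RInt_proj_le p q : 0 <= p -> 0 <= q ->
  RInt (fun t => Rmax (p * cos t) (q * sin t)) 0 (PI / 2) <= sqrt (p * p + q * q).
Proof.
  intros Hp Hq. pose proof PI_RGT_0.
  (* [s] is the angle where the two curves cross: its tangent is [p / q], or it is [PI / 2] when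
     [q = 0]. *)
  assert (X : exists s, 0 <= s <= PI / 2 /\
    (forall t, 0 <= t <= s -> q * sin t <= p * cos t) /\
    (forall t, s <= t <= PI / 2 -> p * cos t <= q * sin t)).
  { destruct Hq as [Hq|<-].
    - set (s := atan (p / q)).
      pose proof (atan_bound (p / q)).
      assert (0 <= s).
      { unfold s. destruct Hp as [Hp|<-].
        - left. rewrite <- atan_0. apply atan_increasing. now apply Rdiv_lt_0_compat.
        - unfold Rdiv; rewrite Rmult_0_l, atan_0; lra. }
      assert (Hs : s < PI / 2) by (unfold s; lra).
      assert (Ht : p * cos s = q * sin s).
      { pose proof (tan_atan (p / q)) as T. fold s in T. unfold tan in T.
        pose proof (cos_gt_0 s ltac:(lra) Hs).
        assert (sin s = p / q * cos s) by (rewrite <- T; field; lra).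
        rewrite H3; field; lra. }
      exists s; repeat split; try lra; intros t Htt.
      + pose proof (cos_decr_1 t s ltac:(lra) ltac:(lra) ltac:(lra) ltac:(lra) ltac:(lra)).
        pose proof (sin_incr_1 t s ltac:(lra) ltac:(lra) ltac:(lra) ltac:(lra) ltac:(lra)).
        nra.
      + pose proof (cos_decr_1 s t ltac:(lra) ltac:(lra) ltac:(lra) ltac:(lra) ltac:(lra)).
        pose proof (sin_incr_1 s t ltac:(lra) ltac:(lra) ltac:(lra) ltac:(lra) ltac:(lra)).
        nra.
    - exists (PI / 2); repeat split; try lra; intros t Htt.
      + pose proof (cos_ge_0 t ltac:(lra) ltac:(lra)); nra.
      + replace t with (PI / 2) by lra. rewrite cos_PI2; lra. }
  destruct X as (s & Hs & H1 & H2).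
  rewrite <- (RInt_Chasles _ 0 s (PI / 2)) by apply ex_RInt_proj.
  rewrite (RInt_ext _ (fun t => p * cos t) 0 s).
  2:{ rewrite Rmin_left, Rmax_right by lra. intros t Ht. apply Rmax_left, H1; lra. }
  rewrite (RInt_ext _ (fun t => q * sin t) s (PI / 2)).
  2:{ rewrite Rmin_left, Rmax_right by lra. intros t Ht. apply Rmax_right, H2; lra. }
  rewrite (is_RInt_unique _ _ _ _ (is_RInt_cos p 0 s)).
  rewrite (is_RInt_unique _ _ _ _ (is_RInt_sin q s (PI / 2))).
  rewrite sin_0, cos_PI2. change plus with Rplus.
  (* The integral equals [p * sin s + q * cos s], which Cauchy-Schwarz bounds. *)
  apply Rsqr_incr_0_var; [|apply sqrt_pos].
  rewrite Rsqr_sqrt by nra. unfold Rsqr.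
  pose proof (sin2_cos2 s) as E; unfold Rsqr in E.
  pose proof (Rle_0_sqr (p * cos s - q * sin s)) as S; unfold Rsqr in S.
  replace (p * p + q * q) with ((p * p + q * q) * (sin s * sin s + cos s * cos s))
    by (rewrite E; ring). nra.
Qed.

Lemma ex_RInt_proj_sum (X Y : nat -> R) n a b :
  ex_RInt (fun t => rsum (fun i => Rmax (Y i * cos t) (X i * sin t)) n) a b.
Proof.
  induction n as [|n IH]; simpl.
  - apply ex_RInt_const.
  - apply (ex_RInt_plus (V := R_NormedModule)); [exact IH | apply ex_RInt_proj].
Qed.

Lemma RInt_proj_sum_le (X Y : nat -> R) n :
  (forall i, 0 <= X i) -> (forall i, 0 <= Y i) ->
  RInt (fun t => rsum (fun i => Rmax (Y i * cos t) (X i * sin t)) n) 0 (PI / 2)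
  <= rsum (fun i => sqrt (Y i * Y i + X i * X i)) n.
Proof.
  intros HX HY; induction n as [|n IH]; simpl.
  - rewrite RInt_const. unfold scal; simpl; unfold mult; simpl. lra.
  - eapply Rle_trans; [right|].
    + apply (RInt_plus (V := R_CompleteNormedModule)
        (fun t => rsum (fun i => Rmax (Y i * cos t) (X i * sin t)) n)
        (fun t => Rmax (Y n * cos t) (X n * sin t)) 0 (PI / 2)
        (ex_RInt_proj_sum X Y n 0 (PI / 2)) (ex_RInt_proj (Y n) (X n) 0 (PI / 2))).
    + apply Rplus_le_compat; [exact IH | now apply RInt_proj_le].
Qed.

(** For the break points a and b of the integration below, the first inequality makes the total
    coefficient [2 * cos b - cos a] of [k] nonnegative, and twice the second gives the coefficient
    2.2781 of [w]. Taylor partial sums prove both. *)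
Lemma caliper_numerics :
  cos (956 / 1000) <= 2 * cos (12782 / 10000) /\
  113905 / 100000 <= sin (956 / 1000) + 12782 / 10000 - 956 / 1000.
Proof.
  pose proof PI2_3_2.
  pose proof (proj2 (cos_bound (956 / 1000) 1 ltac:(lra) ltac:(lra))) as C1.
  pose proof (proj1 (cos_bound (12782 / 10000) 2 ltac:(lra) ltac:(lra))) as C2.
  pose proof (proj1 (sin_bound (956 / 1000) 1 ltac:(lra) ltac:(lra))) as S1.
  assert (F : forall k, INR (fact (S k)) = (INR k + 1) * INR (fact k))
    by (intros k; rewrite fact_simpl, mult_INR, S_INR; ring).
  unfold cos_approx, cos_term, sin_approx, sin_term in *.
  cbn [sum_f_R0 Nat.mul Nat.add] in *.
  rewrite !F in *. change (INR (fact 0)) with 1 in *.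
  cbn [INR pow] in *. lra.
Qed.

(* Integrate [2 w cos t], [2 w - k sin t] and [k sin t] over [0, a], [a, b], [b, PI / 2].
   When [cos a = 2 cos b] the terms in [k] cancel; a and b are rational approximations of
   the best such pair, which gives the length 2.27829 of the shortest arc of width 1. *)
Lemma open_planar_bound (X Y : nat -> R) n w k :
  (forall i, 0 <= X i) -> (forall i, 0 <= Y i) -> 0 <= w -> 0 <= k ->
  2 * w <= rsum Y n -> k <= rsum X n ->
  (forall t, 0 <= t <= PI / 2 ->
     2 * w - k * sin t <= rsum (fun i => Rmax (Y i * cos t) (X i * sin t)) n) ->
  22781 / 10000 * w <= rsum (fun i => sqrt (Y i * Y i + X i * X i)) n.
Proof.
  intros HX HY Hw Hk H1 H3 H2.
  eapply Rle_trans; [|apply RInt_proj_sum_le; auto].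
  set (a := 956 / 1000). set (b := 12782 / 10000).
  destruct caliper_numerics as [N1 N2]; fold a b in N1, N2.
  assert (Hab : 0 < a < b /\ b < PI / 2) by (pose proof PI2_3_2; unfold a, b; lra).
  set (F := fun t => rsum (fun i => Rmax (Y i * cos t) (X i * sin t)) n) in *.
  assert (EF : forall x y, ex_RInt F x y) by (intros; apply ex_RInt_proj_sum).
  rewrite <- (RInt_Chasles F 0 a (PI / 2)), <- (RInt_Chasles F a b (PI / 2)) by apply EF.
  change plus with Rplus.
  assert (I1 : 2 * w * sin a <= RInt F 0 a).
  { pose proof (is_RInt_cos (2 * w) 0 a) as E. rewrite sin_0 in E.
    replace (2 * w * sin a) with (2 * w * sin a - 2 * w * 0) by ring.
    rewrite <- (is_RInt_unique _ _ _ _ E).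
    apply RInt_le; [lra | now exists (2 * w * sin a - 2 * w * 0) | apply EF |].
    intros t Ht. pose proof (cos_ge_0 t ltac:(lra) ltac:(lra)).
    apply Rle_trans with (rsum (fun i => cos t * Y i) n).
    - rewrite rsum_scal. nra.
    - apply rsum_le; intros i _. rewrite Rmult_comm. apply Rmax_l. }
  assert (I2 : 2 * w * (b - a) - k * (cos a - cos b) <= RInt F a b).
  { assert (E : is_RInt (fun t => 2 * w - k * sin t) a b
                  (2 * w * (b - a) - k * (cos a - cos b))).
    { replace (2 * w * (b - a) - k * (cos a - cos b))
        with ((2 * w * b + k * cos b) - (2 * w * a + k * cos a)) by ring.
      apply (is_RInt_derive (V := R_CompleteNormedModule)
               (fun t => 2 * w * t + k * cos t)); intros t _.
      - auto_derive; auto; ring.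
      - apply continuity_pt_filterlim; reg. }
    rewrite <- (is_RInt_unique _ _ _ _ E).
    apply RInt_le; [lra | eexists; exact E | apply EF |].
    intros t Ht. apply H2; lra. }
  assert (I3 : k * cos b <= RInt F b (PI / 2)).
  { pose proof (is_RInt_sin k b (PI / 2)) as E. rewrite cos_PI2 in E.
    replace (k * cos b) with (k * cos b - k * 0) by ring.
    rewrite <- (is_RInt_unique _ _ _ _ E).
    apply RInt_le; [lra | eexists; exact E | apply EF |].
    intros t Ht. pose proof (sin_ge_0 t ltac:(lra) ltac:(lra)).
    apply Rle_trans with (rsum (fun i => sin t * X i) n).
    - rewrite rsum_scal. nra.
    - apply rsum_le; intros i _. rewrite Rmult_comm. apply Rmax_r. }
  unfold a, b in *. nra.
Qed.

Lemma closed_planar_bound (X Y : nat -> R) n w :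
  (forall i, 0 <= X i) -> (forall i, 0 <= Y i) ->
  (forall t, 0 <= t <= PI / 2 ->
     2 * w <= rsum (fun i => Rmax (Y i * cos t) (X i * sin t)) n) ->
  PI * w <= rsum (fun i => sqrt (Y i * Y i + X i * X i)) n.
Proof.
  intros HX HY H. pose proof PI_RGT_0.
  eapply Rle_trans; [|apply RInt_proj_sum_le; auto].
  apply Rle_trans with (RInt (fun _ => 2 * w) 0 (PI / 2)).
  - rewrite RInt_const. unfold scal; simpl; unfold mult; simpl. lra.
  - apply RInt_le; [lra | apply ex_RInt_const | apply ex_RInt_proj_sum |].
    intros t Ht; apply H; lra.
Qed.

(** * From projections to space *)

(** Termwise Cauchy-Schwarz against the vector [(A, B)]. If the two sums are at least [A * w] and
    [B * w], the length is at least [sqrt (A ^ 2 + B ^ 2) * w]. *)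
Lemma combine_projections (r z : nat -> R) n A B : 0 <= A -> 0 <= B ->
  A * rsum r n + B * rsum z n
  <= sqrt (A ^ 2 + B ^ 2) * rsum (fun i => sqrt (r i * r i + z i * z i)) n.
Proof.
  intros HA HB. rewrite <- !rsum_scal, <- rsum_plus. apply rsum_le; intros i _.
  rewrite <- sqrt_mult by nra.
  destruct (Rle_dec 0 (A * r i + B * z i)) as [Hp|Hn].
  - rewrite <- (sqrt_square (A * r i + B * z i)) by lra.
    apply sqrt_le_1_alt. pose proof (Rle_0_sqr (A * z i - B * r i)) as S; unfold Rsqr in S. nra.
  - eapply Rle_trans; [|apply sqrt_pos]; lra.
Qed.

(** The polygon with vertices [P 0] to [P n] has width at least [w]. *)
Definition spans (P : nat -> R3) (n : nat) (w : R) : Prop :=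
  forall u, norm3 u = 1 -> exists i j, (i <= n)%nat /\ (j <= n)%nat /\
    w <= dot3 u (P i) - dot3 u (P j).

Lemma unit_norm u : dot3 u u = 1 -> norm3 u = 1.
Proof. intros H; unfold norm3; rewrite H; apply sqrt_1. Qed.

Lemma variation_dot u P n :
  variation (fun i => dot3 u (P i)) n
  = rsum (fun i => Rabs (dot3 u (sub3 (P (S i)) (P i)))) n.
Proof.
  unfold variation; induction n as [|n IH]; simpl; [|rewrite IH, dot3_sub]; reflexivity.
Qed.

(* Adding the variations in the directions [cos t v + sin t x] and [cos t v - sin t x],
   each closed up by the chord, which is normal to [v]. *)
Lemma planar_variation (P : nat -> R3) n w u v t :
  spans P n w -> dot3 u u = 1 -> dot3 v v = 1 -> dot3 v u = 0 ->
  dot3 v (sub3 (P n) (P O)) = 0 -> 0 <= t <= PI / 2 ->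
  2 * w - Rabs (dot3 (cross3 u v) (sub3 (P n) (P O))) * sin t
  <= rsum (fun i => Rmax (Rabs (dot3 v (sub3 (P (S i)) (P i))) * cos t)
                         (Rabs (dot3 (cross3 u v) (sub3 (P (S i)) (P i))) * sin t)) n.
Proof.
  intros HP Hu Hv Huv Hc Ht. pose proof PI_RGT_0.
  pose proof (cos_ge_0 t ltac:(lra) ltac:(lra)) as Hcos.
  pose proof (sin_ge_0 t ltac:(lra) ltac:(lra)) as Hsin.
  set (x := cross3 u v).
  assert (Hx : dot3 x x = 1 /\ dot3 v x = 0).
  { split.
    - transitivity (dot3 u u * dot3 v v - dot3 v u * dot3 v u).
      + unfold x; destruct u as [[? ?] ?], v as [[? ?] ?]; simpl; ring.
      + rewrite Hu, Hv, Huv; ring.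
    - unfold x; destruct u as [[? ?] ?], v as [[? ?] ?]; simpl; ring. }
  assert (D : forall s, Rabs s = sin t ->
    2 * w - Rabs (dot3 x (sub3 (P n) (P O))) * sin t <=
    rsum (fun i => Rabs (cos t * dot3 v (sub3 (P (S i)) (P i))
                         + s * dot3 x (sub3 (P (S i)) (P i)))) n).
  { intros s Hs.
    set (e := add3 (scale3 (cos t) v) (scale3 s x)).
    assert (He : norm3 e = 1).
    { apply unit_norm. unfold e.
      rewrite dot3_add, !dot3_scale, (dot3_comm v), (dot3_comm x), !dot3_add, !dot3_scale.
      rewrite (dot3_comm x v), Hv, (proj1 Hx), (proj2 Hx).
      pose proof (sin2_cos2 t) as E; unfold Rsqr in E.
      assert (s * s = sin t * sin t) by (rewrite <- Hs; unfold Rabs; destruct Rcase_abs; ring).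
      lra. }
    destruct (HP e He) as (i & j & Hi & Hj & Hw).
    pose proof (variation_closed_range (fun i => dot3 e (P i)) n i j Hi Hj) as V.
    cbv beta in V. rewrite <- (dot3_sub _ (P n)), variation_dot in V.
    assert (E : forall q, dot3 e q = cos t * dot3 v q + s * dot3 x q)
      by (intros q; unfold e; now rewrite dot3_add, !dot3_scale).
    (* The chord is normal to [v], so its component along [e] has size [sin t] times that along
       [x]. *)
    rewrite (E (sub3 (P n) (P O))), Hc, Rmult_0_r, Rplus_0_l, Rabs_mult, Hs in V.
    assert (V2 : rsum (fun i => Rabs (dot3 e (sub3 (P (S i)) (P i)))) n <=
       rsum (fun i => Rabs (cos t * dot3 v (sub3 (P (S i)) (P i))
                         + s * dot3 x (sub3 (P (S i)) (P i)))) n)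
      by (apply rsum_le; intros k _; rewrite E; lra).
    lra. }
  pose proof (D (sin t) (Rabs_pos_eq _ Hsin)) as D1.
  pose proof (D (- sin t) ltac:(rewrite Rabs_Ropp; apply Rabs_pos_eq, Hsin)) as D2.
  clear D.
  (* Termwise, [|p + q| + |p - q|] is twice the maximum of [|p|] and [|q|]. *)
  match goal with |- _ <= ?G => assert (S :
    rsum (fun i => Rabs (cos t * dot3 v (sub3 (P (S i)) (P i))
                         + sin t * dot3 x (sub3 (P (S i)) (P i)))) n +
    rsum (fun i => Rabs (cos t * dot3 v (sub3 (P (S i)) (P i))
                         + - sin t * dot3 x (sub3 (P (S i)) (P i)))) n <= 2 * G) end.
  { rewrite <- rsum_plus, <- rsum_scal. apply rsum_le; intros i _.
    generalize (dot3 v (sub3 (P (S i)) (P i))) (dot3 x (sub3 (P (S i)) (P i))).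
    intros p q.
    rewrite <- (Rabs_pos_eq (cos t)) at 3 by exact Hcos.
    rewrite <- (Rabs_pos_eq (sin t)) at 3 by exact Hsin.
    rewrite <- !Rabs_mult, (Rmult_comm p), (Rmult_comm q).
    rewrite Ropp_mult_distr_l_reverse.
    generalize (cos t * p) (sin t * q); intros p' q'.
    unfold Rmax; destruct Rle_dec; abs_lra. }
  lra.
Qed.

(** The weights of planar length and height variation are the constants of their own lower bounds,
    2.2781 and 3, or [PI] and 4, which is the best choice in [combine_projections]. [d] is the
    tolerance of the balanced direction. *)
Lemma polygon_length_bound (P : nat -> R3) n w d :
  0 <= w -> 0 < d -> spans P n w ->
  let l := rsum (fun i => norm3 (sub3 (P (S i)) (P i))) n in
  (22781 / 10000) ^ 2 * w + 3 * (3 * w - 30 * d) <= sqrt ((22781 / 10000) ^ 2 + 3 ^ 2) * l /\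
  (P n = P O -> PI ^ 2 * w + 4 * (4 * w - 40 * d) <= sqrt (PI ^ 2 + 4 ^ 2) * l).
Proof.
  intros Hw Hd HP l.
  destruct (exists_balanced_direction P n d Hd) as (u & Hu & B2 & B3).
  pose proof (variation_of_balanced _ n w d Hd (HP u Hu) B2 B3) as [Z3 Z4].
  rewrite variation_dot in Z3, Z4.
  assert (Hu1 : dot3 u u = 1) by (rewrite <- norm3_sqr, Hu; ring).
  destruct (exists_normal u (sub3 (P n) (P O)) Hu1) as (v & Hv & Hvu & Hvc).
  pose proof (fun t => planar_variation P n w u v t HP Hu1 Hv Hvu Hvc) as M.
  set (X := fun i => Rabs (dot3 (cross3 u v) (sub3 (P (S i)) (P i)))).
  set (Y := fun i => Rabs (dot3 v (sub3 (P (S i)) (P i)))).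
  set (Z := fun i => Rabs (dot3 u (sub3 (P (S i)) (P i)))) in *.
  set (k := Rabs (dot3 (cross3 u v) (sub3 (P n) (P O)))) in *.
  set (rho := fun i => sqrt (Y i * Y i + X i * X i)).
  assert (HX : forall i, 0 <= X i) by (intros; apply Rabs_pos).
  assert (HY : forall i, 0 <= Y i) by (intros; apply Rabs_pos).
  assert (El : rsum (fun i => sqrt (rho i * rho i + Z i * Z i)) n <= l).
  { apply rsum_le; intros i _. right. unfold norm3; f_equal.
    rewrite (orthonormal_frame u v _ Hu1 Hv Hvu).
    unfold rho; rewrite sqrt_sqrt by nra. unfold X, Y, Z.
    assert (A : forall r, Rabs r * Rabs r = r * r)
      by (intros r; unfold Rabs; destruct Rcase_abs; ring).
    rewrite !A; ring. }
  assert (R2 : 22781 / 10000 * w <= rsum rho n).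
  { apply open_planar_bound with (k := k); auto.
    - apply Rabs_pos.
    - destruct (HP v (unit_norm v Hv)) as (i & j & Hi & Hj & Hij).
      pose proof (variation_closed_range (fun i => dot3 v (P i)) n i j Hi Hj) as V.
      cbv beta in V. rewrite <- (dot3_sub _ (P n)), Hvc, Rabs_R0, variation_dot in V. fold Y in V. lra.
    - pose proof (variation_increment (fun i => dot3 (cross3 u v) (P i)) 0 n ltac:(lia)) as V.
      cbv beta in V. rewrite <- (dot3_sub _ (P n)), variation_dot in V. fold k X in V.
      unfold variation in V; simpl in V; lra. }
  split.
  - pose proof (combine_projections rho Z n (22781 / 10000) 3 ltac:(lra) ltac:(lra)) as C.
    pose proof (Rmult_le_compat_l _ _ _ (sqrt_pos ((22781 / 10000) ^ 2 + 3 ^ 2)) El). nra.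
  - intros Hcl. pose proof PI_RGT_0.
    assert (R1 : PI * w <= rsum rho n).
    { apply closed_planar_bound; auto. intros t Ht.
      specialize (M t Ht). assert (k = 0) as E.
      { unfold k. rewrite Hcl. destruct (P O) as [[? ?] ?], (cross3 u v) as [[? ?] ?]; simpl.
        rewrite !Rminus_diag, !Rmult_0_r, !Rplus_0_r. apply Rabs_R0. }
      rewrite E in M. fold X Y in M. unfold X, Y. lra. }
    specialize (Z4 ltac:(now rewrite Hcl)).
    pose proof (combine_projections rho Z n PI 4 ltac:(lra) ltac:(lra)) as C.
    pose proof (Rmult_le_compat_l _ _ _ (sqrt_pos (PI ^ 2 + 4 ^ 2)) El). nra.
Qed.

(** * Inscribed polygons of nearly full width *)

Lemma abs_coord_le_norm x y z :
  Rabs x <= norm3 (x, y, z) /\ Rabs y <= norm3 (x, y, z) /\ Rabs z <= norm3 (x, y, z).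
Proof.
  unfold norm3; simpl.
  repeat split; rewrite <- sqrt_Rsqr_abs; apply sqrt_le_1_alt; unfold Rsqr; nra.
Qed.

Lemma uniform_continuity_of_coord (q : R3 -> R) gamma a b eps :
  (forall p p', Rabs (q p - q p') <= dist3 p p') ->
  a <= b -> continuous_on_interval gamma a b -> 0 < eps ->
  exists d, 0 < d /\ forall s t, a <= s <= b -> a <= t <= b -> Rabs (s - t) < d ->
    Rabs (q (gamma s) - q (gamma t)) < eps.
Proof.
  intros Hq Hab Hc He.
  (* [clamp] extends the curve by constants beyond the end points, giving the two-sided continuity
     that Heine's theorem asks for. *)
  set (clamp := fun t => Rmax a (Rmin b t)).
  assert (C1 : forall t, a <= clamp t <= b).
  { intros t; unfold clamp, Rmax, Rmin; repeat destruct Rle_dec; lra. }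
  assert (C2 : forall t, a <= t <= b -> clamp t = t).
  { intros t Ht; unfold clamp, Rmax, Rmin; repeat destruct Rle_dec; lra. }
  assert (C3 : forall s t, Rabs (clamp s - clamp t) <= Rabs (s - t)).
  { intros s t; unfold clamp, Rmax, Rmin; repeat destruct Rle_dec; abs_lra. }
  destruct (Heine_cor2 (f := fun t => q (gamma (clamp t))) (a := a) (b := b)) with (eps := mkposreal eps He)
    as [d Hd].
  - intros t _ e Hpos. destruct (Hc (clamp t) (C1 t) e Hpos) as (d & Hd & Hs).
    exists d; split; auto. intros s [_ Hst]. simpl in *. unfold Rdist in *.
    eapply Rle_lt_trans; [apply Hq|]. apply Hs; auto.
    eapply Rle_lt_trans; [apply C3 | exact Hst].
  - exists d; split; [apply cond_pos|]. intros s t Hs Ht Hst.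
    specialize (Hd s t Hs Ht Hst). simpl in Hd. now rewrite !C2 in Hd by auto.
Qed.

(** Unit vectors have coordinates of size at most 1, so one modulus [d] serves all directions, and
    later one partition does too. *)
Lemma uniform_direction_continuity gamma a b eps :
  a <= b -> continuous_on_interval gamma a b -> 0 < eps ->
  exists d, 0 < d /\ forall s t u, a <= s <= b -> a <= t <= b -> Rabs (s - t) < d ->
    norm3 u = 1 -> Rabs (dot3 u (gamma s) - dot3 u (gamma t)) < eps.
Proof.
  intros Hab Hc He.
  destruct (uniform_continuity_of_coord (fun '(x, y, z) => x) gamma a b (eps / 3)) as (d1 & P1 & D1);
    auto; [|lra|].
  { intros [[x y] z] [[x' y'] z']. apply (abs_coord_le_norm (x - x') (y - y') (z - z')). }
  destruct (uniform_continuity_of_coord (fun '(x, y, z) => y) gamma a b (eps / 3)) as (d2 & P2 & D2);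
    auto; [|lra|].
  { intros [[x y] z] [[x' y'] z']. apply (abs_coord_le_norm (x - x') (y - y') (z - z')). }
  destruct (uniform_continuity_of_coord (fun '(x, y, z) => z) gamma a b (eps / 3)) as (d3 & P3 & D3);
    auto; [|lra|].
  { intros [[x y] z] [[x' y'] z']. apply (abs_coord_le_norm (x - x') (y - y') (z - z')). }
  exists (Rmin d1 (Rmin d2 d3)); split; [now repeat apply Rmin_glb_lt|].
  intros s t u Hs Ht Hst Hu.
  pose proof (Rmin_l d1 (Rmin d2 d3)). pose proof (Rmin_r d1 (Rmin d2 d3)).
  pose proof (Rmin_l d2 d3). pose proof (Rmin_r d2 d3).
  specialize (D1 s t Hs Ht ltac:(lra)). specialize (D2 s t Hs Ht ltac:(lra)).
  specialize (D3 s t Hs Ht ltac:(lra)).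
  destruct u as [[u1 u2] u3]. destruct (abs_coord_le_norm u1 u2 u3) as (U1 & U2 & U3).
  rewrite Hu in U1, U2, U3.
  destruct (gamma s) as [[x y] z], (gamma t) as [[x' y'] z']; simpl.
  replace (u1 * x + u2 * y + u3 * z - (u1 * x' + u2 * y' + u3 * z'))
    with (u1 * (x - x') + u2 * (y - y') + u3 * (z - z')) by ring.
  assert (A : forall v r, Rabs v <= 1 -> Rabs (v * r) <= Rabs r).
  { intros v r Hv. rewrite Rabs_mult. pose proof (Rabs_pos r). nra. }
  pose proof (A u1 (x - x') U1). pose proof (A u2 (y - y') U2). pose proof (A u3 (z - z') U3).
  pose proof (Rabs_triang (u1 * (x - x') + u2 * (y - y')) (u3 * (z - z'))).
  pose proof (Rabs_triang (u1 * (x - x')) (u2 * (y - y'))). lra.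
Qed.

(** On a fine uniform partition every curve point is within [eps / 2] in height of a vertex. The
    slab of the vertices, widened by [eps / 2] on each side, contains the curve, so its thickness is
    at least [w]. *)
Lemma exists_spanning_partition gamma a b w eps :
  a <= b -> continuous_on_interval gamma a b -> curve_width gamma a b w -> 0 < eps ->
  exists t k, is_partition a b t k /\ spans (fun i => gamma (t i)) k (w - eps).
Proof.
  intros Hab Hc [Hw _] He.
  destruct (uniform_direction_continuity gamma a b (eps / 2) Hab Hc ltac:(lra)) as (d & Hd & HU).
  destruct (INR_unbounded ((b - a) / d)) as [N HN].
  set (n := S N).
  assert (Hn : (b - a) / d < INR n) by (unfold n; rewrite S_INR; lra).
  assert (Hn0 : 0 < INR n) by (apply lt_0_INR; unfold n; lia).
  set (h := (b - a) / INR n).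
  assert (Hh0 : 0 <= h) by (unfold h; apply Rdiv_le_0_compat; lra).
  assert (Hnh : INR n * h = b - a) by (unfold h; field; lra).
  assert (Hh : h < d).
  { apply (Rmult_lt_reg_l (INR n)); auto. rewrite Hnh.
    replace (b - a) with ((b - a) / d * d) by (field; lra).
    now apply Rmult_lt_compat_r. }
  set (t := fun i => a + INR i * h).
  assert (Ht : forall i, (i <= n)%nat -> a <= t i <= b).
  { intros i Hi; unfold t. apply le_INR in Hi. pose proof (pos_INR i). nra. }
  assert (Hnear : forall k s, a <= s <= t k -> exists i, (i <= k)%nat /\ Rabs (s - t i) < d).
  { induction k as [|k IH]; intros s Hs.
    - exists O; split; auto. unfold t in *; simpl in *. apply Rabs_def1; lra.
    - destruct (Rle_dec s (t k)) as [Hsk|Hsk].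
      + destruct (IH s ltac:(lra)) as (i & Hi & Hi'). exists i; split; auto.
      + exists (S k); split; auto.
        assert (t (S k) = t k + h) by (unfold t; rewrite S_INR; ring).
        apply Rabs_def1; lra. }
  assert (Hb : t n = b) by (unfold t; lra).
  exists t, n; split; [split; [|split]|].
  - unfold t; simpl; ring.
  - exact Hb.
  - intros i _; unfold t; rewrite S_INR; lra.
  - intros u Hu.
    set (p := fun i => dot3 u (gamma (t i))).
    destruct (smax_attained p n) as (i & Hi & Ei).
    destruct (smax_attained (fun i => - p i) n) as (j & Hj & Ej).
    exists i, j; repeat split; auto. change (w - eps <= p i - p j).
    assert (w <= p i - p j + eps); [|lra].
    assert (Hp : forall s, a <= s <= b -> p j - eps / 2 <= dot3 u (gamma s) <= p i + eps / 2).
    { intros s Hs. destruct (Hnear n s ltac:(lra)) as (l & Hl & Hsl).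
      pose proof (HU s (t l) u Hs (Ht l Hl) Hsl Hu) as A.
      change (dot3 u (gamma (t l))) with (p l) in A.
      pose proof (smax_ge p n l Hl). pose proof (smax_ge (fun i => - p i) n l Hl) as B.
      cbv beta in B, Ej. rewrite Ei in *. rewrite Ej in B. apply Rabs_def2 in A. lra. }
    apply Hw; split.
    + pose proof (Hp a ltac:(lra)). lra.
    + exists u, (p j - eps / 2); split; auto.
      intros s Hs. specialize (Hp s Hs). lra.
Qed.

(** * Passage from polygons to the curve *)

Lemma poly_sum_rsum gamma t k :
  poly_sum gamma t k = rsum (fun i => norm3 (sub3 (gamma (t (S i))) (gamma (t i)))) k.
Proof. induction k as [|k IH]; simpl; [|rewrite IH]; reflexivity. Qed.

Lemma le_of_le_plus_eps x y c : 0 <= c -> (forall e, 0 < e -> x <= y + c * e) -> x <= y.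
Proof.
  intros Hc H. apply Rnot_lt_le; intros Hxy.
  specialize (H ((x - y) / (2 * (c + 1))) ltac:(apply Rdiv_lt_0_compat; lra)).
  assert (c * ((x - y) / (2 * (c + 1))) < x - y).
  { apply (Rmult_lt_reg_r (2 * (c + 1))); [lra|].
    replace (c * ((x - y) / (2 * (c + 1))) * (2 * (c + 1))) with (c * (x - y)) by (field; lra).
    nra. }
  lra.
Qed.

Lemma le_of_sqrt_scaled s w L : 0 < s -> s * w <= sqrt s * L -> sqrt s * w <= L.
Proof.
  intros Hs H. pose proof (sqrt_lt_R0 s Hs).
  apply (Rmult_le_reg_l (sqrt s)); auto. rewrite <- Rmult_assoc, sqrt_sqrt; lra.
Qed.

Theorem theorem1p1 (gamma : R -> R3) (a b L w : R) :
  a <= b ->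
  continuous_on_interval gamma a b ->
  rectifiable_with_length gamma a b L ->
  curve_width gamma a b w ->
  L >= 37669 / 10000 * w /\
  (gamma a = gamma b -> L >= sqrt (PI ^ 2 + 16) * w).
Proof.
  intros Hab Hc [HL _] HW.
  assert (Hw : 0 <= w) by (apply (proj2 HW); intros x [Hx _]; exact Hx).
  destruct Hw as [Hw|<-].
  (* For [w = 0] there is no positive [e <= w] to work with, and the claim reduces to [0 <= L]. *)
  2:{ assert (0 <= L).
      { destruct (exists_spanning_partition gamma a b 0 1 Hab Hc HW ltac:(lra)) as (t & k & Hp & _).
        apply Rle_trans with (poly_sum gamma t k); [|apply HL; now exists t, k].
        rewrite poly_sum_rsum.
        apply Rle_trans with (rsum (fun _ => 0 * 0) k); [rewrite rsum_scal; lra|].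
        apply rsum_le; intros i _; rewrite Rmult_0_l; apply sqrt_pos. }
      split; intros; rewrite Rmult_0_r; lra. }
  pose proof PI_RGT_0.
  (* Using [w - e] for [w] and the tolerance [e] costs 2.2781^2 + 99 times [e] in the open case and
     [PI ^ 2 + 176] times [e] in the closed one; [300 + PI ^ 2] covers both. *)
  assert (Q : forall e, 0 < e ->
    ((22781 / 10000) ^ 2 + 3 ^ 2) * w
      <= sqrt ((22781 / 10000) ^ 2 + 3 ^ 2) * L + (300 + PI ^ 2) * e /\
    (gamma a = gamma b ->
      (PI ^ 2 + 4 ^ 2) * w <= sqrt (PI ^ 2 + 4 ^ 2) * L + (300 + PI ^ 2) * e)).
  { intros e0 He0. set (e := Rmin e0 w).
    assert (He : 0 < e /\ e <= e0 /\ e <= w).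
    { unfold e; split; [now apply Rmin_glb_lt | split; [apply Rmin_l | apply Rmin_r]]. }
    destruct (exists_spanning_partition gamma a b w e Hab Hc HW (proj1 He)) as (t & k & Hp & Hs).
    destruct (polygon_length_bound _ k (w - e) e ltac:(lra) (proj1 He) Hs) as [B1 B2].
    cbv zeta beta in B1, B2. rewrite <- poly_sum_rsum in B1, B2.
    assert (Hl : poly_sum gamma t k <= L) by (apply HL; now exists t, k).
    split.
    - pose proof (Rmult_le_compat_l _ _ _ (sqrt_pos ((22781 / 10000) ^ 2 + 3 ^ 2)) Hl). nra.
    - intros Hcl. destruct Hp as (Ha & Hb & _).
      specialize (B2 ltac:(now rewrite Ha, Hb)).
      pose proof (Rmult_le_compat_l _ _ _ (sqrt_pos (PI ^ 2 + 4 ^ 2)) Hl). nra. }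
  assert (HP2 : 0 <= 300 + PI ^ 2) by nra.
  split.
  - assert (B : sqrt ((22781 / 10000) ^ 2 + 3 ^ 2) * w <= L).
    { apply le_of_sqrt_scaled; [lra|].
      apply le_of_le_plus_eps with (300 + PI ^ 2); auto. intros e He; now apply Q. }
    (* A narrow margin: 3.7669^2 = 14.18953... and 2.2781^2 + 9 = 14.18973... *)
    assert (37669 / 10000 <= sqrt ((22781 / 10000) ^ 2 + 3 ^ 2)).
    { rewrite <- (sqrt_square (37669 / 10000)) by lra. apply sqrt_le_1_alt; lra. }
    nra.
  - intros Hcl. apply Rle_ge. replace 16 with (4 ^ 2) by ring.
    apply le_of_sqrt_scaled; [nra|].
    apply le_of_le_plus_eps with (300 + PI ^ 2); auto. intros e He; now apply Q.
Qed.
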